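(* The function $K_2$ is continuous on $\big([0,1]\times[0,1]\big)\setminus\{(0,0)\}$.
   Context: Let $K:[0,1]\times[0,1]\to\mathbb R$ be defined by $K(x,y)=\frac12-\{(xy)^{-1}\}$ if $0<x,y\le 1$, and $K(x,y)=0$ if $0\le x,y\le1$ and $xy=0$, where $\{\alpha\}=\alpha-\lfloor\alpha\rfloor$. Define $K_2(x,y)=\int_0^1K(x,z)K(z,y)\,dz$ for $0\le x,y\le1$. *)

(* Defs.v *)
From HB Require Import structures.
From mathcomp Require Import all_boot all_order all_algebra.
From mathcomp Require Import all_classical all_reals all_analysis.
Set Implicit Arguments. Unset Strict Implicit. Unset Printing Implicit Defensive.
Import Order.TTheory GRing.Theory Num.Theory.
Import numFieldNormedType.Exports.
Local Open Scope classical_set_scope.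
Local Open Scope ring_scope.

Definition fracpart (R : realType) (a : R) : R := a - (Num.floor a)%:~R.

Definition K (R : realType) (x y : R) : R :=
  if (0 < x) && (0 < y) then 2^-1 - fracpart ((x * y)^-1) else 0.

Definition K2 (R : realType) (x y : R) : R :=
  Rintegral (@lebesgue_measure R) `[0, 1]%classic (fun z => K x z * K z y).

Definition D0 (R : realType) : set (R * R) :=
  [set p | 0 <= p.1 <= 1 /\ 0 <= p.2 <= 1 /\ p <> (0, 0)].

(* Main.v *)
(** Sequences and dominated convergence. At a point with [x, y > 0] the
integrand [K x z * K z y] converges off the countable set of [z] where
[1 / (x z)] or [1 / (z y)] is an integer.

At [(0, y)] with [y > 0] the value is [0], and [K x z] oscillates as [x] tends
to [0]. On the cell of those [z] with [floor (1 / (x z)) = n], that is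
[1 / (x (n + 1)) < z <= 1 / (x n)], write [t = {1 / (x z)}]; then [K x z] differs
by [t (1 - t) x z] from a function affine in [z] which vanishes at the middle of
the cell. Multiplied by a function constant on each cell this affine part has
integral [0]. Take for this function the value of [K _ y] at the right end of the
cell: it tends to [K z y] for almost every [z], as the right end tends to [z].
Hence the integral of [K x z * K z y'] tends to [0] as [(x, y')] tends to
[(0, y)]. *)

Require Import Defs.
From HB Require Import structures.
From mathcomp Require Import all_boot all_order all_algebra.
From mathcomp Require Import all_classical all_reals all_analysis.
From mathcomp Require Import measurable_realfun ring lra.
Import Order.TTheory GRing.Theory Num.Theory.
Import numFieldNormedType.Exports.
Local Open Scope classical_set_scope.
Local Open Scope ring_scope.
Set Implicit Arguments. Unset Strict Implicit. Unset Printing Implicit Defensive.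

(** * Bounds and measurability of the kernel *)

Lemma fracpart_ge0 (R : realType) (a : R) : 0 <= fracpart a.
Proof. by rewrite /fracpart subr_ge0 floor_le. Qed.

Lemma fracpart_lt1 (R : realType) (a : R) : fracpart a < 1.
Proof. by rewrite /fracpart ltrBlDl -[1]/(1%:~R) -intrD floorD1_gt. Qed.

Lemma normK_le (R : realType) (x y : R) : `|K x y| <= 2^-1.
Proof.
rewrite /K; case: ifP => _; last by rewrite normr0 invr_ge0.
have := fracpart_ge0 (x * y)^-1; have := fracpart_lt1 (x * y)^-1.
by move=> ? ?; rewrite ler_norml; apply/andP; split; lra.
Qed.

Lemma K0l (R : realType) (y : R) : K 0 y = 0.
Proof. by rewrite /K ltxx. Qed.

Lemma KC (R : realType) (x y : R) : K x y = K y x.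
Proof. by rewrite /K andbC mulrC. Qed.

Lemma measurable_funV (R : realType) (D : set R) :
  measurable_fun D (fun x : R => x^-1).
Proof.
apply: (measurable_funS measurableT) => //.
rewrite -(setvU [set 0 : R]); apply/measurable_funU => //; first exact: measurableC.
split; last exact: measurable_fun_set1.
apply: open_continuous_measurable_fun; first exact/closed_openC/closed_eq.
by move=> x; rewrite inE /= => /eqP; exact: inv_continuous.
Qed.

Lemma measurable_fracpart (R : realType) (D : set R) :
  measurable_fun D (@fracpart R).
Proof.
apply: (measurable_funS measurableT) => //; apply: measurable_funB => //.
apply: nondecreasing_measurable => // x y xy.
by rewrite ler_int le_floor.
Qed.

Lemma measurable_K (R : realType) (d : measure_display)
    (T : measurableType d) (D : set T) (f g : T -> R) :
  measurable D -> measurable_fun D f -> measurable_fun D g ->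
  measurable_fun D (fun z => K (f z) (g z)).
Proof.
move=> mD mf mg; rewrite /K; apply: measurable_fun_if => //.
- by apply: measurable_and; apply: measurable_fun_ltr.
- apply: (measurable_funS mD); first exact: subIsetl.
  apply: measurable_funB => //.
  have mV : measurable_fun D (fun x => (f x * g x)^-1).
    exact: (measurableT_comp (@measurable_funV R setT) (measurable_funM mf mg)).
  exact: (measurableT_comp (@measurable_fracpart R setT) mV).
Qed.

(** * Limits of [K] along sequences, and of bounded integrals *)

(** The limit [1 / (x z)] lies strictly between consecutive integers, so the floor is eventually
    constant along the sequence and [K] follows a continuous formula. *)
Lemma cvg_K (R : realType) (x_ z_ : nat -> R) (x z : R) :
  x_ n @[n --> \oo] --> x -> z_ n @[n --> \oo] --> z -> 0 < x -> 0 < z ->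
  fracpart (x * z)^-1 != 0 -> K (x_ n) (z_ n) @[n --> \oo] --> K x z.
Proof.
move=> xx zz x0 z0 frac0.
have cu : (x_ n * z_ n)^-1 @[n --> \oo] --> (x * z)^-1.
  by apply: cvgV; [rewrite mulf_neq0 ?gt_eqF|exact: cvgM].
set u := (x * z)^-1 in cu frac0.
have cK : 2^-1 - ((x_ n * z_ n)^-1 - (Num.floor u)%:~R) @[n --> \oo] --> K x z.
  rewrite /K x0 z0 /=; apply: cvgB; first exact: cvg_cst.
  by apply: cvgB => //; exact: cvg_cst.
apply: cvg_trans cK; apply: near_eq_cvg.
have lu : (Num.floor u)%:~R < u.
  by rewrite -subr_gt0 lt_def frac0 fracpart_ge0.
have ru : u < (Num.floor u + 1)%:~R by rewrite floorD1_gt.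
near=> n; rewrite /K.
have -> : 0 < x_ n by near: n; exact: (cvgr_gt x).
have -> : 0 < z_ n by near: n; exact: (cvgr_gt z).
rewrite /= /fracpart; congr (_ - (_ - _%:~R)); symmetry; apply: floor_def.
apply/andP; split; first by apply/ltW; near: n; exact: (cvgr_gt u).
by near: n; exact: (cvgr_lt u).
Unshelve. all: by end_near. Qed.

Lemma bounded_integrable (R : realType) (D : set R) (f : R -> R) (M : R) :
  measurable D -> (lebesgue_measure D < +oo)%E -> measurable_fun D f ->
  (forall z, D z -> `|f z| <= M) -> lebesgue_measure.-integrable D (EFin \o f).
Proof.
move=> mD Doo mf fM; apply: measurable_bounded_integrable => //.
exists M; split; first exact: num_real.
by move=> N /ltW MN z Dz /=; exact: le_trans (fM z Dz) MN.
Qed.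

(** Dominated convergence with a constant majorant. The exceptional sets met below consist of jumps
    of [K] and of end points, so countable ones suffice. *)
Lemma cvg_Rintegral_bounded (R : realType) (D N : set R) (f_ : nat -> R -> R)
    (f : R -> R) (M : R) :
  measurable D -> (lebesgue_measure D < +oo)%E -> countable N ->
  (forall n, measurable_fun D (f_ n)) -> measurable_fun D f ->
  (forall n z, D z -> `|f_ n z| <= M) ->
  (forall z, D z -> ~ N z -> f_ n z @[n --> \oo] --> f z) ->
  Rintegral lebesgue_measure D (f_ n) @[n --> \oo] --> Rintegral lebesgue_measure D f.
Proof.
move=> mD Doo cN mf_ mf f_M f_f.
have N0 : lebesgue_measure.-negligible N.
  exists N; split => //.
    exact: countable_measurable.
  exact: countable_lebesgue_measure0.
have [] := @dominated_convergence _ _ _ (@lebesgue_measure R) _ mD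
  (fun n => EFin \o f_ n) (EFin \o f) (EFin \o cst M).
- by move=> n; apply/measurable_EFinP; exact: mf_.
- by apply/measurable_EFinP; exact: mf.
- apply: negligibleS N0 => z /= H; apply: contrapT => Nz; apply: H => Dz.
  by apply/cvg_EFin; [exact: nearW|exact: f_f].
- by apply: (bounded_integrable (M := `|M|)).
- by apply: aeW => z n Dz /=; rewrite lee_fin f_M.
move=> fi _ cv; apply: fine_cvg; rewrite fineK; first exact: cv.
exact: integrable_fin_num.
Qed.

(** * The sawtooth and the step function *)

(* The part of [K x] that is affine on each cell, see [saw_cell]. *)
Definition saw (R : realType) (x z : R) : R :=
  K x z - fracpart (x * z)^-1 * (1 - fracpart (x * z)^-1) * (x * z).

(* The right end of the cell containing [z]; it is [0] when [1 < x * z]. *)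
Definition cell_top (R : realType) (x z : R) : R :=
  (x * (Num.floor (x * z)^-1)%:~R)^-1.

(* Truncated to cells contained in [0, 1], so that only whole cells contribute to
   the integral over [0, 1]. *)
Definition stepK (R : realType) (x y z : R) : R :=
  if cell_top x z <= 1 then K (cell_top x z) y else 0.

Lemma normr_stepK_le (R : realType) (x y z : R) : `|stepK x y z| <= 2^-1.
Proof.
rewrite /stepK; case: ifP => _; first exact: normK_le.
by rewrite normr0 invr_ge0.
Qed.

(** The difference is [t (1 - t) x z] with [0 <= t < 1]. It vanishes as [x] tends to [0], so [saw]
    can replace [K] in the limit. *)
Lemma normr_K_sub_saw_le (R : realType) (x z : R) : 0 <= x * z ->
  `|K x z - saw x z| <= x * z.
Proof.
move=> xz0; rewrite /saw opprB addrC subrK.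
have := fracpart_ge0 (x * z)^-1; have := fracpart_lt1 (x * z)^-1.
move: (fracpart _) => t t1 t0.
have tt0 : 0 <= t * (1 - t) by apply: mulr_ge0; lra.
rewrite ger0_norm; first by rewrite ler_piMl//; nra.
exact: mulr_ge0.
Qed.

(** The factors are at most [1/2 + 1] and [1/2], so the product is at most [3/4]. *)
Lemma normr_saw_stepK_le (R : realType) (x y z : R) : 0 <= x * z <= 1 ->
  `|saw x z * stepK x y z| <= 1.
Proof.
move=> /andP[xz0 xz1]; rewrite normrM.
have := normr_K_sub_saw_le xz0; have := normK_le x z.
have := normr_stepK_le x y z; have := normr_ge0 (stepK x y z).
have : `|saw x z| <= `|K x z| + `|K x z - saw x z|.
  by rewrite (le_trans _ (ler_normB _ _))// opprB addrC subrK.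
have := normr_ge0 (saw x z).
move: (`|_|) (`|_|) (`|_|) (`|_|) => a b c e *; nra.
Qed.

Lemma measurable_cell_top (R : realType) (x : R) :
  measurable_fun setT (cell_top x).
Proof.
have mV : measurable_fun setT (fun z => (x * z)^-1).
  exact: (measurableT_comp (@measurable_funV R setT) (mulrl_measurable _)).
have mF : measurable_fun setT (fun z => x * (Num.floor (x * z)^-1)%:~R).
  apply: measurable_funM => //.
  rewrite [X in measurable_fun _ X](_ : _ =
    (fun z => (x * z)^-1) \- (@fracpart R \o (fun z => (x * z)^-1))).
    apply: measurable_funB => //.
    exact: (measurableT_comp (@measurable_fracpart R setT) mV).
  by apply/funext => z /=; rewrite /fracpart subKr.
exact: (measurableT_comp (@measurable_funV R setT) mF).
Qed.

Lemma measurable_saw_stepK (R : realType) (x y : R) :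
  measurable_fun setT (fun z => saw x z * stepK x y z).
Proof.
apply: measurable_funM; last first.
  apply: measurable_fun_if => //.
  - by apply: measurable_fun_ler => //; exact: measurable_cell_top.
  - apply: (measurable_funS measurableT) => //.
    by apply: measurable_K => //; exact: measurable_cell_top.
apply: measurable_funB; first exact: measurable_K.
have mf : measurable_fun setT (fun z => fracpart (x * z)^-1).
  apply: (measurableT_comp (@measurable_fracpart R setT)).
  exact: (measurableT_comp (@measurable_funV R setT) (mulrl_measurable _)).
apply: measurable_funM => //; apply: measurable_funM => //.
exact: measurable_funB.
Qed.

(** * Cancellation on the cells *)

(** The integral of an affine function is the length of the interval times the value at the
    midpoint. *)
Lemma Rintegral_affine_eq0 (R : realType) (a b p q : R) : a < b ->
  p + q * ((a + b) / 2) = 0 ->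
  Rintegral lebesgue_measure `]a, b] (fun z => p + q * z) = 0.
Proof.
move=> ab pq.
have cf : continuous (fun z : R => p + q * z).
  move=> z; apply: cvgD; first exact: cvg_cst.
  by apply: cvgM; [exact: cvg_cst|exact: cvg_id].
have intf : lebesgue_measure.-integrable `[a, b] (EFin \o (fun z : R => p + q * z)).
  apply: continuous_compact_integrable; first exact: segment_compact.
  exact: continuous_subspaceT.
rewrite Rintegral_itv_obnd_cbnd; last first.
  by apply: integrableS intf => //; exact: subset_itv_oc_cc.
pose F (z : R) : R := p * z + q / 2 * z ^+ 2.
have dF (z : R) : is_derive z 1 F (p + q * z).
  apply: is_derive_eq; rewrite /GRing.scale /=; lra.
rewrite /Rintegral (@continuous_FTC2 _ _ F)//=.
- rewrite /F; have -> : p = - (q * ((a + b) / 2)) by lra.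
  lra.
- exact: continuous_subspaceT.
- have cF : continuous F.
    by move=> z; apply/differentiable_continuous/derivable1_diffP.
  split => //.
  + exact/cvg_at_right_filter/cF.
  + exact/cvg_at_left_filter/cF.
- by move=> z _; rewrite derive1E derive_val.
Qed.

Lemma floor_cell (R : realType) (x z : R) (n : nat) : 0 < x -> (0 < n)%N ->
  (x * n.+1%:R)^-1 < z <= (x * n%:R)^-1 -> Num.floor (x * z)^-1 = n%:Z.
Proof.
move=> x0 n0 /andP[zl zr].
have nR0 : 0 < n%:R :> R by rewrite ltr0n.
have z0 : 0 < z by apply: lt_trans zl; rewrite invr_gt0 mulr_gt0.
apply: floor_def; rewrite -[(_ + 1)%:~R]/(n + 1)%:R addn1 -[n%:~R]/(n%:R).
have xz0 : 0 < x * z by rewrite mulr_gt0.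
apply/andP; split.
  rewrite -[_^-1]mul1r ler_pdivlMr// mulrA -[_ * z]mulrC -ler_pdivlMr ?mulr_gt0//.
  by rewrite mul1r [n%:R * x]mulrC.
rewrite -[_^-1]mul1r ltr_pdivrMr// mulrA -[_ * z]mulrC -ltr_pdivrMr ?mulr_gt0//.
by rewrite mul1r [_ * x]mulrC.
Qed.

(** With [u = 1 / (x z)] and [t = u - n], the correction [t (1 - t) / u] is
    [2 n + 1 - u - n (n + 1) / u]. Its [- u] cancels the one in [1/2 - t], and [1 / u = x z] is
    linear in [z]. *)
Lemma saw_cell (R : realType) (x z : R) (n : nat) : 0 < x -> (0 < n)%N ->
  (x * n.+1%:R)^-1 < z <= (x * n%:R)^-1 ->
  saw x z = - (n%:R + 2^-1) + n%:R * n.+1%:R * x * z.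
Proof.
move=> x0 n0 zn; have fl := floor_cell x0 n0 zn.
have z0 : 0 < z.
  by case/andP: zn => zl _; apply: lt_trans zl; rewrite invr_gt0 mulr_gt0 ?ltr0n.
rewrite /saw /K /fracpart x0 z0 /= fl -[n%:~R]/(n%:R) -[n.+1]addn1 natrD.
have : x != 0 by rewrite gt_eqF.
have : z != 0 by rewrite gt_eqF.
by move=> ? ?; field; apply/andP.
Qed.

Lemma Rintegral_cell (R : realType) (x y : R) (n : nat) : 0 < x -> (0 < n)%N ->
  Rintegral lebesgue_measure `](x * n.+1%:R)^-1, (x * n%:R)^-1]
    (fun z => saw x z * stepK x y z) = 0.
Proof.
move=> x0 n0.
have nR0 : 0 < n%:R :> R by rewrite ltr0n.
pose c : R := (x * n%:R)^-1.
pose C : R := if c <= 1 then K c y else 0.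
transitivity (Rintegral lebesgue_measure `](x * n.+1%:R)^-1, c]
    (fun z => - (n%:R + 2^-1) * C + n%:R * n.+1%:R * x * C * z)).
  apply: eq_Rintegral => z; rewrite inE /= in_itv /= => zn.
  rewrite (saw_cell x0 n0 zn) /stepK /cell_top (floor_cell x0 n0 zn).
  by rewrite -[n%:~R]/(n%:R) -/c -/C; ring.
apply: Rintegral_affine_eq0.
  by rewrite ltf_pV2 ?posrE ?mulr_gt0// ltr_pM2l// ltr_nat.
(* The midpoint of the cell is [(2 n + 1) / (2 x n (n + 1))], the zero of the affine part. *)
rewrite /c -[n.+1]addn1 natrD; move: (C) => C'.
have ? : x != 0 by rewrite gt_eqF.
have ? : n%:R != 0 :> R by rewrite gt_eqF.
have ? : n%:R + 1 != 0 :> R by rewrite gt_eqF// addr_gt0.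
by field; apply/and3P.
Qed.

Lemma saw_stepK_integrable (R : realType) (x y : R) (i : interval R) : 0 < x ->
  [set` i] `<=` `[0, x^-1] ->
  lebesgue_measure.-integrable [set` i] (EFin \o (fun z => saw x z * stepK x y z)).
Proof.
move=> x0 i0; suff : lebesgue_measure.-integrable `[0, x^-1]
    (EFin \o (fun z => saw x z * stepK x y z)) by apply: integrableS.
apply: (bounded_integrable (M := 1)) => //.
- by rewrite /= lebesgue_measure_itv /= lte_fin invr_gt0 x0 -EFinB ltry.
- apply: (measurable_funS measurableT) => //; exact: measurable_saw_stepK.
- move=> z /=; rewrite in_itv /= => /andP[z0 zx]; apply: normr_saw_stepK_le.
  by rewrite mulr_ge0 ?(ltW x0)//= mulrC -ler_pdivlMr// div1r.
Qed.

(** The cells of index [1] to [n] tile this interval, which is empty for [n = 0]; induction adds one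
    cell at a time. *)
Lemma Rintegral_cells (R : realType) (x y : R) (n : nat) : 0 < x ->
  Rintegral lebesgue_measure `](x * n.+1%:R)^-1, x^-1]
    (fun z => saw x z * stepK x y z) = 0.
Proof.
move=> x0; elim: n => [|n IH].
  by rewrite mulr1 set_itvoc0 Rintegral_set0.
have h : (x * n.+2%:R)^-1 <= (x * n.+1%:R)^-1.
  by rewrite lef_pV2 ?posrE ?mulr_gt0 ?ltr0n// ler_pM2l// ler_nat.
have h' : (x * n.+1%:R)^-1 <= x^-1.
  by rewrite lef_pV2 ?posrE ?mulr_gt0 ?ltr0n// ler_peMr ?(ltW x0)// ler1n.
have := @Rintegral_itvB _ (fun z => saw x z * stepK x y z)
  (BRight (x * n.+2%:R)^-1) (BRight x^-1) (x * n.+1%:R)^-1.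
rewrite Rintegral_cell// subr0 => ->//.
apply: saw_stepK_integrable => // z /=; rewrite !in_itv /= => /andP[z0 ->].
rewrite andbT; apply/ltW; apply: le_lt_trans z0.
by rewrite invr_ge0 mulr_ge0 ?(ltW x0)// ler0n.
Qed.

(** The right end of the cell is at least [z], hence exceeds [1], and the truncation applies. *)
Lemma stepK_eq0 (R : realType) (x y z : R) : 0 < x -> 1 < z -> stepK x y z = 0.
Proof.
move=> x0 z1; have z0 : 0 < z by exact: lt_trans z1.
have xz0 : 0 < x * z by exact: mulr_gt0.
rewrite /stepK /cell_top; case: ifPn => //; have := floor_le (x * z)^-1.
have : (0 <= Num.floor (x * z)^-1) by rewrite floor_ge0 invr_ge0 ltW.
(* For floor [0] the inverse of [0] makes [cell_top] equal to [0], which passes the test; there [K]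
   itself vanishes. *)
case: (Num.floor _) => // -[|n] _; first by rewrite mulr0 invr0 K0l.
rewrite -[_%:~R]/(n.+1%:R) => nxz h; exfalso; move: h; apply/negP.
rewrite -ltNge (lt_le_trans z1)// -[z]invrK lef_pV2 ?posrE ?invr_gt0 ?mulr_gt0 ?ltr0n//.
by rewrite -ler_pdivlMl// -invfM.
Qed.

(** The cells exhaust the interval from [0] to [1 / x] except for the point [0], so the integral
    over it is a limit of zeros; beyond [1] the integrand vanishes. *)
Lemma Rintegral_saw_stepK (R : realType) (x y : R) : 0 < x <= 1 ->
  Rintegral lebesgue_measure `[0, 1] (fun z => saw x z * stepK x y z) = 0.
Proof.
move=> /andP[x0 x1]; pose W (z : R) := saw x z * stepK x y z; rewrite -/W.
have V1 : 1 <= x^-1 by rewrite invf_ge1.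
have mW : measurable_fun setT W by exact: measurable_saw_stepK.
have Wc : Rintegral lebesgue_measure `[0, x^-1] W = 0.
  (* [f_ n] keeps the first [n] cells; each [z > 0] is eventually covered. *)
  pose f_ n := W \_ `](x * n.+1%:R)^-1, x^-1].
  have f0 n : Rintegral lebesgue_measure `[0, x^-1] (f_ n) = 0.
    rewrite -Rintegral_mkcondr setIidr; first exact: Rintegral_cells.
    move=> z /=; rewrite !in_itv /= => /andP[z0 ->].
    rewrite andbT; apply/ltW; apply: le_lt_trans z0.
    by rewrite invr_ge0 mulr_ge0 ?(ltW x0)// ler0n.
  have := @cvg_Rintegral_bounded _ `[0, x^-1] [set 0] f_ W 1.
  rewrite (_ : (fun n => _) = cst 0); last by apply/funext => n; rewrite f0.
  have H : cst (0 : R) @ \oo --> (0 : R) by exact: cvg_cst.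
  move=> G; apply/esym; apply: (cvg_unique _ H); first exact: Rhausdorff.
  apply: G => //.
  - by rewrite /= lebesgue_measure_itv /= lte_fin invr_gt0 x0 -EFinB ltry.
  - move=> n; apply/(measurable_restrict _ _ _).1 => //.
    exact: (measurable_funS measurableT).
  - exact: (measurable_funS measurableT).
  - move=> n z /=; rewrite in_itv /= => /andP[z0 zx].
    rewrite /f_ patchE; case: ifPn => _; last by rewrite normr0.
    apply: normr_saw_stepK_le.
    by rewrite mulr_ge0 ?(ltW x0)//= mulrC -ler_pdivlMr// div1r.
  - move=> z /=; rewrite in_itv /= => /andP[z0 zx] /eqP zn0.
    have {zn0} z0' : 0 < z by rewrite lt_def zn0.
    have xz0 : 0 < x * z by rewrite mulr_gt0.
    apply: cvg_near_cst; near=> n.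
    rewrite /f_ patchE mem_set//= in_itv /= zx andbT.
    rewrite -[z]invrK ltf_pV2 ?posrE ?invr_gt0 ?mulr_gt0 ?ltr0n//.
    rewrite -ltr_pdivrMl// -invfM.
    apply: (@lt_trans _ _ n%:R); last by rewrite ltr_nat.
    by near: n; exact: nbhs_infty_gtr.
have sub : `[0, 1] `<=` `[0, x^-1].
  by move=> z /=; rewrite !in_itv /= => /andP[-> z1]; exact: le_trans z1 V1.
(* The domain can be enlarged because [stepK] is [0] beyond [1]: a cell straddling [1] was dropped
   as a whole. *)
rewrite -[RHS]Wc -(setIidr sub).
rewrite Rintegral_mkcondr; apply: eq_Rintegral => z; rewrite inE /= in_itv /=.
move=> /andP[z0 zx]; rewrite patchE; case: ifPn => //.
rewrite notin_setE /= in_itv /= z0 /= => /negP; rewrite -ltNge => z1.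
by rewrite /W stepK_eq0// mulr0.
Unshelve. all: by end_near. Qed.

(** * Convergence where both coordinates are positive *)

(** For [w > 0], the points [z] where [1 / (w z)] is an integer. The index [m = 0] contributes
    [z = 0], as the inverse of [0] is [0]. *)
Definition nodes (R : realType) (w : R) : set R :=
  range (fun m : int => (w * m%:~R)^-1).

Lemma countable_nodes (R : realType) (w : R) : countable (nodes w).
Proof. exact: sub_countable (card_image_le _ _) (countableP _). Qed.

Lemma fracpart_neq0 (R : realType) (w z : R) : 0 < w -> ~ nodes w z ->
  fracpart (w * z)^-1 != 0.
Proof.
move=> w0 nz; apply/eqP => /eqP; rewrite subr_eq0 => /eqP uz; apply: nz.
exists (Num.floor (w * z)^-1) => //; rewrite -uz invfM invrK mulrA mulVf ?mul1r//.
by rewrite gt_eqF.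
Qed.

Lemma nodes0 (R : realType) (w : R) : nodes w 0.
Proof. by exists 0; rewrite // mulr0 invr0. Qed.

Lemma measurable_KK (R : realType) (x y : R) (D : set R) :
  measurable_fun D (fun z => K x z * K z y).
Proof.
apply: (measurable_funS measurableT) => //.
by apply: measurable_funM; exact: measurable_K.
Qed.

Lemma normr_KK_le (R : realType) (x y z : R) : `|K x z * K z y| <= 1.
Proof.
rewrite normrM; have := normK_le x z; have := normK_le z y.
have := normr_ge0 (K x z); have := normr_ge0 (K z y); nra.
Qed.

Lemma lebesgue_measure01_lty (R : realType) :
  (@lebesgue_measure R `[0%R, 1%R] < +oo)%E.
Proof. by rewrite lebesgue_measure_itv /= lte01 -EFinB ltry. Qed.

Lemma cvg_K2_gt0 (R : realType) (x_ y_ : nat -> R) (x y : R) :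
  x_ n @[n --> \oo] --> x -> y_ n @[n --> \oo] --> y -> 0 < x -> 0 < y ->
  K2 (x_ n) (y_ n) @[n --> \oo] --> K2 x y.
Proof.
move=> xx yy x0 y0; rewrite /K2.
apply: (@cvg_Rintegral_bounded _ _ (nodes x `|` nodes y) _ _ 1) => //.
- exact: lebesgue_measure01_lty.
- by rewrite -bigcup2E; apply: bigcup_countable => // -[|[|]] // _;
    exact: countable_nodes.
- by move=> n; exact: measurable_KK.
- exact: measurable_KK.
- by move=> n z _; exact: normr_KK_le.
- move=> z /=; rewrite in_itv /= => /andP[z0 z1] nz.
  have {}z0 : 0 < z.
    rewrite lt_def z0 andbT; apply/eqP => z0'; apply: nz; left; rewrite z0'.
    exact: nodes0.
  apply: cvgM; apply: cvg_K => //; try exact: cvg_cst.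
  + by apply: fracpart_neq0 => // ?; apply: nz; left.
  + by rewrite mulrC; apply: fracpart_neq0 => // ?; apply: nz; right.
Qed.

(** * Convergence at the axes *)

(** In this form, for [x > 0], the reciprocal of the right end visibly differs from [1 / z] by less
    than [x]. *)
Lemma cell_topE (R : realType) (x z : R) : x != 0 -> z != 0 ->
  cell_top x z = (z^-1 - x * fracpart (x * z)^-1)^-1.
Proof.
move=> x0 z0; rewrite /cell_top /fracpart; congr (_^-1).
by move: (_%:~R) => m; field; apply/andP.
Qed.

Lemma cvg_cell_top (R : realType) (x_ : nat -> R) (z : R) :
  (forall n, 0 < x_ n) -> x_ n @[n --> \oo] --> 0 -> 0 < z ->
  cell_top (x_ n) z @[n --> \oo] --> z.
Proof.
move=> x0 xx z0; have z0' : z != 0 by rewrite gt_eqF.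
under eq_cvg do rewrite cell_topE ?gt_eqF//.
have xf : x_ n * fracpart (x_ n * z)^-1 @[n --> \oo] --> 0.
  apply: (@squeeze_cvgr _ _ _ _ (cst 0) x_) => //; last exact: cvg_cst.
  apply: nearW => n; rewrite mulr_ge0 ?fracpart_ge0 ?(ltW (x0 n))//=.
  by rewrite ler_piMr ?(ltW (x0 n))// ltW// fracpart_lt1.
have zV0 : z^-1 - 0 != 0 by rewrite subr0 invr_eq0.
by have := cvgV zV0 (cvgB (cvg_cst z^-1) xf); rewrite subr0 invrK; exact.
Qed.

(** The right end tends to [z < 1], so the truncation is eventually inactive, and [K _ y] is
    continuous at [z] off the nodes. *)
Lemma cvg_stepK (R : realType) (x_ : nat -> R) (y z : R) :
  (forall n, 0 < x_ n) -> x_ n @[n --> \oo] --> 0 -> 0 < y -> 0 < z < 1 ->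
  ~ nodes y z -> stepK (x_ n) y z @[n --> \oo] --> K z y.
Proof.
move=> x0 xx y0 /andP[z0 z1] nz; have ct := cvg_cell_top x0 xx z0.
have cK : K (cell_top (x_ n) z) y @[n --> \oo] --> K z y.
  apply: cvg_K => //; first exact: cvg_cst.
  by rewrite mulrC; exact: fracpart_neq0.
apply: cvg_trans cK; apply: near_eq_cvg; near=> n; rewrite /stepK.
by have -> : cell_top (x_ n) z <= 1 by apply: ltW; near: n; exact: (cvgr_lt z).
Unshelve. all: by end_near. Qed.

(** The subtracted product has integral [0] for every [y0]. Below, [y0] is the limit of the second
    coordinates, so the step function depends on [n] through [x_ n] only. *)
Lemma K2_saw (R : realType) (x y y0 : R) : 0 < x <= 1 ->
  K2 x y = Rintegral lebesgue_measure `[0, 1]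
    (fun z => K x z * K z y - saw x z * stepK x y0 z).
Proof.
move=> /andP[x0 x1]; rewrite RintegralB//.
- by rewrite Rintegral_saw_stepK ?x0// subr0.
- apply: (bounded_integrable (M := 1)) => //.
  + exact: lebesgue_measure01_lty.
  + exact: measurable_KK.
  + by move=> z _; exact: normr_KK_le.
- apply: saw_stepK_integrable => // z /=; rewrite !in_itv /= => /andP[-> z1].
  by rewrite (le_trans z1)// invf_ge1.
Qed.

Lemma cvg_K2_0 (R : realType) (x_ y_ : nat -> R) (y : R) :
  (forall n, 0 < x_ n <= 1) -> 0 < y ->
  x_ n @[n --> \oo] --> 0 -> y_ n @[n --> \oo] --> y ->
  K2 (x_ n) (y_ n) @[n --> \oo] --> 0.
Proof.
move=> x01 y0 xx yy; have x0 n : 0 < x_ n by case/andP: (x01 n).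
under eq_cvg do rewrite (K2_saw _ y)//.
suff : Rintegral lebesgue_measure `[0, 1]
    (fun z => K (x_ n) z * K z (y_ n) - saw (x_ n) z * stepK (x_ n) y z)
    @[n --> \oo] --> Rintegral lebesgue_measure `[0, 1] (cst (0 : R)).
  by rewrite Rintegral_cst// mul0r; exact.
(* The point [1] is excluded because [cvg_stepK] needs [z < 1]; the bound [2] adds the bounds [1] of
   the two products. *)
apply: (@cvg_Rintegral_bounded _ _ (nodes y `|` [set 1]) _ _ 2) => //.
- exact: lebesgue_measure01_lty.
- rewrite -bigcup2E; apply: bigcup_countable => // -[|[|]] // _.
    exact: countable_nodes.
  exact: countable1.
- move=> n; apply: measurable_funB; first exact: measurable_KK.
  by apply: (measurable_funS measurableT) => //; exact: measurable_saw_stepK.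
- move=> n z /=; rewrite in_itv /= => /andP[z0 z1].
  rewrite (le_trans (ler_normB _ _))// -[2]/(1 + 1) lerD ?normr_KK_le//.
  case/andP: (x01 n) => _ xn1.
  apply: normr_saw_stepK_le; rewrite mulr_ge0 ?(ltW (x0 n))//=.
  by rewrite -[1]mulr1 ler_pM// ltW.
- move=> z /=; rewrite in_itv /= => /andP[z0 z1] nz.
  have {}z0 : 0 < z.
    rewrite lt_def z0 andbT; apply/eqP => z0'; apply: nz; left; rewrite z0'.
    exact: nodes0.
  have {}z1 : z < 1.
    by rewrite lt_neqAle z1 andbT; apply/eqP => z1'; apply: nz; right.
  have {}nz : ~ nodes y z by move=> ?; apply: nz; left.
  have z01 : 0 < z < 1 by rewrite z0.
  have cS := cvg_stepK x0 xx y0 z01 nz.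
  have cKy : K z (y_ n) @[n --> \oo] --> K z y.
    apply: cvg_K => //; first exact: cvg_cst.
    by rewrite mulrC; exact: fracpart_neq0.
  have cg : `|K z (y_ n) - stepK (x_ n) y z| + x_ n * z @[n --> \oo] --> 0.
    have := cvgD (cvg_norm (cvgB cKy cS)) (cvgM xx (cvg_cst z)).
    by rewrite subrr normr0 mul0r addr0; exact.
  apply/norm_cvg0P; apply: (@squeeze_cvgr _ _ _ _ (cst 0) _ _ _ 0 (cvg_cst 0) cg).
  apply: nearW => n; rewrite normr_ge0 /=.
  (* Both summands are small: in the first the bracket tends to [0] and [K] is bounded, in the
     second the bracket is at most [x_ n * z]. *)
  rewrite (_ : _ - _ = K (x_ n) z * (K z (y_ n) - stepK (x_ n) y z) +
    (K (x_ n) z - saw (x_ n) z) * stepK (x_ n) y z); last by ring.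
  rewrite (le_trans (ler_normD _ _))// lerD// normrM.
    by rewrite ler_piMl// (le_trans (normK_le _ _))// invf_le1// ler1n.
  rewrite -[leRHS]mulr1 ler_pM//.
    by apply: normr_K_sub_saw_le; rewrite mulr_ge0 ?ltW.
  by rewrite (le_trans (normr_stepK_le _ _ _))// invf_le1// ler1n.
Qed.

(** * Symmetry, and continuity from sequences *)

Lemma K2C (R : realType) (x y : R) : K2 x y = K2 y x.
Proof.
by apply: eq_Rintegral => z _; rewrite mulrC KC [K x z]KC.
Qed.

Lemma K2_0l (R : realType) (y : R) : K2 0 y = 0.
Proof.
rewrite -[RHS](mul0r (fine (@lebesgue_measure R `[0, 1]))) -Rintegral_cst//.
by apply: eq_Rintegral => z _; rewrite K0l mul0r.
Qed.

(** If continuity fails at [p], points of [A] within [1 / (n + 1)] of [p] can be chosen with values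
    at least [e] away from [f p]. Hence only sequences avoiding the value [f p] need testing, which
    later removes points on the axes. *)
Lemma within_continuous_seq (R : realType) (T : pseudoMetricType R)
    (A : set T) (f : T -> R) :
  (forall (p : T) (p_ : nat -> T), A p -> (forall n, A (p_ n)) ->
    (forall n, f (p_ n) <> f p) -> p_ n @[n --> \oo] --> p ->
    f (p_ n) @[n --> \oo] --> f p) ->
  {within A, continuous f}.
Proof.
move=> seqf; apply/subspace_continuousP => p Ap; apply/cvgrPdist_lt => e e0.
apply: contrapT => nfp.
have bad n : exists q, [/\ A q, ball p n.+1%:R^-1 q & e <= `|f p - f q|].
  apply: contrapT => nq; apply: nfp.
  have : \forall q \near p, ball p n.+1%:R^-1 q by exact: nbhsx_ballx.
  rewrite /= near_withinE; apply: filterS => q pq Aq; rewrite ltNge; apply/negP => efq.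
  by apply: nq; exists q.
have [p_ p_P] := choice bad.
have pp : p_ n @[n --> \oo] --> p.
  apply/cvg_ballP => d d0; near=> n; have [_ pn _] := p_P n.
  apply: le_ball pn; apply/ltW; near: n; exact: near_infty_natSinv_lt (PosNum d0).
have fpn n : f (p_ n) <> f p.
  by have [_ _] := p_P n => /[swap] ->; rewrite subrr normr0 leNgt e0.
have := seqf p p_ Ap (fun n => let: And3 a _ _ := p_P n in a) fpn pp.
move=> /cvgrPdist_lt/(_ e e0) [n _ /(_ n (leqnn n))] /=.
by have [_ _] := p_P n; rewrite leNgt => /negP.
Unshelve. all: by end_near. Qed.

Theorem theorem2p7 (R : realType) :
  {within @D0 R, continuous (fun p : R * R => K2 p.1 p.2)}.
Proof.
apply: within_continuous_seq => -[x y] p_ /=.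
move=> [/andP[x0 x1] [/andP[y0 y1] xyn0]] Dp Kp pp.
have px : (p_ n).1 @[n --> \oo] --> x by exact: (cvg_comp _ _ pp cvg_fst).
have py : (p_ n).2 @[n --> \oo] --> y by exact: (cvg_comp _ _ pp cvg_snd).
have [x_0|xn0] := eqVneq x 0.
  have {}y0 : 0 < y.
    by rewrite lt_def y0 andbT; apply/eqP => y_0; apply: xyn0; rewrite x_0 y_0.
  move: px Kp; rewrite {}x_0 K2_0l => px Kp; apply: (@cvg_K2_0 _ _ _ y) => // n.
  (* A term with first coordinate [0] would have the limit value [0], against [Kp]; so all first
     coordinates are positive. *)
  have [/andP[pn0 ->] _] := Dp n; rewrite andbT lt_def pn0 andbT.
  by apply/eqP => pn; apply: (Kp n); rewrite pn K2_0l.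
have {}x0 : 0 < x by rewrite lt_def xn0.
have [y_0|yn0] := eqVneq y 0; last first.
  by apply: cvg_K2_gt0 => //; rewrite lt_def yn0.
(* The remaining case [y = 0 < x] follows by symmetry. *)
under eq_cvg do rewrite K2C.
move: py Kp; rewrite {}y_0 K2C K2_0l => py Kp; apply: (@cvg_K2_0 _ _ _ x) => // n.
have [_ [/andP[pn0 ->] _]] := Dp n; rewrite andbT lt_def pn0 andbT.
by apply/eqP => pn; apply: (Kp n); rewrite pn K2C K2_0l.
Qed.
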